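(* Let $d\ge 1$. Let $F\colon\mathbb{R}\to\left]-\infty,+\infty\right]$ be a lower semicontinuous convex function such that the interior of $\operatorname{dom}F$ is $\left]0,+\infty\right[$, $F$ is differentiable in $\left]0,+\infty\right[$, and $L_0:=\lim_{\xi\downarrow 0}F'(\xi)\in\mathbb{R}\cup\{-\infty\}$. Let $\Psi\colon\mathbb{R}\times\mathbb{R}^d\to\left]-\infty,+\infty\right]$ be given by $\Psi(\rho,\boldsymbol{m})=F(\rho)$. Let $p>1$, $q=p/(p-1)$, and define $\Phi_p\colon\mathbb{R}\times\mathbb{R}^d\to\left]-\infty,+\infty\right]$ by $$\Phi_p(\rho,\boldsymbol{m})=\begin{cases}\dfrac{|\boldsymbol{m}|^q}{q\rho^{q-1}},&\text{if }\rho>0;\\[3mm]0,&\text{if }\rho=0\text{ and }\boldsymbol{m}=0;\\ +\infty,&\text{otherwise}.\end{cases}$$ Then, for every $\gamma>0$ and every $(\rho,\boldsymbol{m})\in\mathbb{R}\times\mathbb{R}^d$, $$\operatorname{Prox}_{\gamma(\Phi_p+\Psi)}(\rho,\boldsymbol{m})=\begin{cases}(0,0),&\text{if }\rho+\dfrac{|\boldsymbol{m}|^p}{p\gamma^{p-1}}\le\gamma L_0;\\[3mm](\theta,\boldsymbol{v}),&\text{if }\rho+\dfrac{|\boldsymbol{m}|^p}{p\gamma^{p-1}}>\gamma L_0,\end{cases}$$ where, in the second case, $\operatorname{Prox}_{\gamma F}\rho\ge 0$ and $\theta$ is the unique solution $t=\theta$ to $R(t)=0$ among $t>0$ with $t\ge\operatorname{Prox}_{\gamma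 F}\rho$, where $$R(t)=\left(\gamma\big(t+\gamma F'(t)-\rho\big)^{1/p}+t\left(\frac{p}{\gamma}\right)^{1-2/p}\big(t+\gamma F'(t)-\rho\big)^{1-1/p}\right)^p-\frac{\gamma|\boldsymbol{m}|^p}{p},$$ and $$\boldsymbol{v}=\left(\frac{\theta}{\theta+\gamma^{2/q}p^{1-2/q}\big(\theta+\gamma F'(\theta)-\rho\big)^{1-2/q}}\right)\boldsymbol{m}\quad\text{if }\boldsymbol{m}\neq 0,\qquad \boldsymbol{v}=0\quad\text{if }\boldsymbol{m}=0.$$
   Context: $|\cdot|$ denotes the Euclidean norm. For $f\colon\mathbb{R}^M\to\left]-\infty,+\infty\right]$, $\operatorname{dom}f=\{x: f(x)<+\infty\}$. For $f$ proper, convex and lower semicontinuous, the proximity operator is $\operatorname{Prox}_f x=\arg\min_{y\in\mathbb{R}^M}\big(f(y)+\tfrac12|y-x|^2\big)$, which is the unique minimizer. The inequality $\,\cdot\le\gamma L_0$ is never satisfied by a real number when $L_0=-\infty$ (so the second case always applies then). *)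

(* Defs.v *)
From HB Require Import structures.
From mathcomp Require Import all_boot all_order all_algebra.
From mathcomp Require Import all_classical all_reals all_analysis.
Set Implicit Arguments.
Unset Strict Implicit.
Unset Printing Implicit Defensive.
Import Order.TTheory GRing.Theory Num.Theory.
Import numFieldNormedType.Exports.
Local Open Scope classical_set_scope.
Local Open Scope ring_scope.

(* The canonical norm `|v| on 'rV[R]_d and on products is the max norm, hence
   these explicit Euclidean norms. *)
Definition enorm (R : realType) (d : nat) (v : 'rV[R]_d) : R :=
  Num.sqrt (\sum_(i < d) v 0 i ^+ 2).

Definition enorm_pair (R : realType) (d : nat) (x : R * 'rV[R]_d) : R :=
  Num.sqrt (x.1 ^+ 2 + enorm x.2 ^+ 2).

Definition argmin (R : realType) (V : Type) (f : V -> \bar R) : set V :=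
  [set y | forall z, (f y <= f z)%E].

(* [is_prox N f x y] reads "y = Prox_f x" for the Euclidean norm N: y is the
   one and only minimizer.  Being relational, it asserts existence and
   uniqueness of the minimizer, without any default value. *)
Definition is_prox (R : realType) (V : zmodType) (N : V -> R)
    (f : V -> \bar R) (x y : V) : Prop :=
  argmin (fun z => (f z + (2^-1 * N (z - x) ^+ 2)%:E)%E) = [set y].

Definition edom (R : realType) (V : Type) (f : V -> \bar R) : set V :=
  [set x | (f x < +oo)%E].

(* The library's [convex_function] only covers real-valued functions. *)
Definition econvex (R : realType) (f : R -> \bar R) : Prop :=
  forall (x y t : R), 0 < t < 1 ->
    (f (t * x + (1 - t) * y)%R <= t%:E * f x + (1 - t)%:E * f y)%E.

(* Derivative of an extended-real-valued function; meaningful in the interior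
   of its domain, where f is finite. *)
Definition ederiv (R : realType) (f : R -> \bar R) : R -> R :=
  derive1 (fine \o f).

Definition Psi (R : realType) (d : nat) (F : R -> \bar R)
    (x : R * 'rV[R]_d) : \bar R := F x.1.

Definition Phi (R : realType) (d : nat) (p : R) (x : R * 'rV[R]_d) : \bar R :=
  let q := p / (p - 1) in
  if 0 < x.1 then (enorm x.2 `^ q / (q * x.1 `^ (q - 1)))%:E
  else if (x.1 == 0) && (x.2 == 0) then 0%E
  else +oo%E.

Definition slack (R : realType) (F : R -> \bar R) (gamma rho t : R) : R :=
  t + gamma * ederiv F t - rho.

Definition Rfun (R : realType) (d : nat) (F : R -> \bar R) (p gamma rho : R)
    (m : 'rV[R]_d) (t : R) : R :=
  let s := slack F gamma rho t in
  (gamma * s `^ (1 / p)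
     + t * (p / gamma) `^ (1 - 2 / p) * s `^ (1 - 1 / p)) `^ p
  - gamma * enorm m `^ p / p.

Definition vsol (R : realType) (d : nat) (F : R -> \bar R) (p gamma rho : R)
    (m : 'rV[R]_d) (theta : R) : 'rV[R]_d :=
  let q := p / (p - 1) in
  let s := slack F gamma rho theta in
  if m == 0 then 0
  else (theta / (theta + gamma `^ (2 / q) * p `^ (1 - 2 / q)
                           * s `^ (1 - 2 / q))) *: m.

(* Main.v *)
Require Import Defs.
From HB Require Import structures.
From mathcomp Require Import all_boot all_order all_algebra.
From mathcomp Require Import all_classical all_reals all_analysis.
From mathcomp Require Import ring lra.
Set Implicit Arguments.
Unset Strict Implicit.
Unset Printing Implicit Defensive.
Import Order.TTheory GRing.Theory Num.Theory.
Import numFieldNormedType.Exports.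
Local Open Scope classical_set_scope.
Local Open Scope ring_scope.

(** If x - y is a subgradient of f at y, then y = Prox_f x: adding the identity
    |z-x|^2/2 = |y-x|^2/2 - <x-y, z-y> + |z-y|^2/2 to the subgradient inequality
    shows that the objective at z exceeds the one at y by at least |z-y|^2/2,
    whence existence and uniqueness of the minimizer at once
    ([is_prox_subgradient]). It remains to exhibit subgradients.

    The function Phi_p is the support function of the convex set of the (a, b)
    with a + |b|^p/p <= 0; only the inequality a t + <b,w> <= Phi_p(t,w) is
    needed, and it is the Young inequality for |b| and |w|/t, multiplied by t
    ([Phi_support]). The function F lies above its tangents at the points t > 0,
    and above the line of slope L0 through (0, F(0)) when L0 is finite, by lower
    semicontinuity ([F_above_tangent], [F_above_tangent0]).

    If rho + |m|^p/(p gamma^(p-1)) <= gamma L0, the choice b = m/gamma,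
    a = -|b|^p/p shows that (rho, m) is a subgradient of gamma (Phi_p + F) at
    the origin ([prox_origin]). Otherwise let s(t) = t + gamma F'(t) - rho,
    and for theta > 0 with s(theta) >= 0 put sigma = p s(theta)/gamma,
    w = sigma^(1/p) and u = sigma^(1/q) = w^(p-1). The equation R(theta) = 0 is
    a rescaled form of gamma w + theta u = |m| ([Rfun_eq0]). Then
    v = (theta u/|m|) m and b = (w/|m|) m satisfy gamma b + v = m, and
    (-s(theta)/gamma, b) is a subgradient of Phi_p at (theta, v), so that
    (theta, v) is the proximal point ([prox_pos], [prox_root]).

    As F is convex, F' is nondecreasing and continuous on the positive axis, so
    that s is continuous and increases at least as fast as t. Hence R is
    strictly increasing where s >= 0 ([Rfun_lt]), whence uniqueness of theta.
    Existence follows from the intermediate value theorem ([Rfun_root]): R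
    becomes nonnegative for large t, and a point where R <= 0 is
    r = Prox_{gamma F} rho itself if r > 0 (there s vanishes), or a point close
    to 0 if r = 0, where L0 is finite and R(t) tends to
    gamma^p (gamma L0 - rho) - gamma |m|^p/p < 0
    ([prox_F_and_Rfun_le0]). *)

(** * Proximal points from subgradients *)

(** Here [h z] stands for the scalar product of [x - y] with [z - y]: the second
    hypothesis is the polarization identity of the norm [N], and the last one
    says that [x - y] is a subgradient of [f] at [y]. *)
Lemma is_prox_subgradient (R : realType) (V : zmodType) (N : V -> R)
    (f : V -> \bar R) (x y : V) (c : R) (h : V -> R) :
  (forall z, N z = 0 -> z = 0) ->
  (forall z, 2^-1 * N (z - x) ^+ 2 =
     2^-1 * N (y - x) ^+ 2 - h z + 2^-1 * N (z - y) ^+ 2) ->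
  f y = c%:E -> (forall z, ((c + h z)%:E <= f z)%E) ->
  is_prox N f x y.
Proof.
move=> N0 hN fy hf.
have key z : ((c + 2^-1 * N (y - x) ^+ 2 + 2^-1 * N (z - y) ^+ 2)%:E
    <= f z + (2^-1 * N (z - x) ^+ 2)%:E)%E.
  apply: le_trans (leeD (hf z) (lexx _)).
  by rewrite -EFinD lee_fin hN; lra.
apply/seteqP; split => [z|z ->] /=; last first.
  move=> w; rewrite fy -EFinD; apply: le_trans (key w).
  by rewrite lee_fin lerDl mulr_ge0 // sqr_ge0.
move=> /(_ y) hz; have := le_trans (key z) hz.
rewrite fy -EFinD lee_fin => hle.
have /eqP : N (z - y) ^+ 2 = 0.
  by apply/eqP; rewrite eq_le sqr_ge0 andbT; lra.
by rewrite expf_eq0 /= => /eqP/N0/eqP; rewrite subr_eq0 => /eqP.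
Qed.

(** The Euclidean scalar product, for which [enorm] is the norm. *)
Definition dot (R : realType) (d : nat) (v w : 'rV[R]_d) : R :=
  \sum_(i < d) v 0 i * w 0 i.

Lemma dotC (R : realType) (d : nat) (v w : 'rV[R]_d) : dot v w = dot w v.
Proof. by apply: eq_bigr => i _; rewrite mulrC. Qed.

Lemma dotBl (R : realType) (d : nat) (u v w : 'rV[R]_d) :
  dot (u - v) w = dot u w - dot v w.
Proof.
by rewrite /dot -sumrB; apply: eq_bigr => i _; rewrite !mxE mulrBl.
Qed.

Lemma dotBr (R : realType) (d : nat) (u v w : 'rV[R]_d) :
  dot u (v - w) = dot u v - dot u w.
Proof. by rewrite dotC dotBl !(dotC u). Qed.

Lemma dotZl (R : realType) (d : nat) (a : R) (v w : 'rV[R]_d) :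
  dot (a *: v) w = a * dot v w.
Proof.
by rewrite /dot mulr_sumr; apply: eq_bigr => i _; rewrite !mxE mulrA.
Qed.

Lemma dotZr (R : realType) (d : nat) (a : R) (v w : 'rV[R]_d) :
  dot v (a *: w) = a * dot v w.
Proof. by rewrite dotC dotZl dotC. Qed.

Lemma dotvv_ge0 (R : realType) (d : nat) (v : 'rV[R]_d) : 0 <= dot v v.
Proof. by apply: sumr_ge0 => i _; rewrite -expr2 sqr_ge0. Qed.

Lemma enorm_ge0 (R : realType) (d : nat) (v : 'rV[R]_d) : 0 <= enorm v.
Proof. exact: sqrtr_ge0. Qed.

Lemma enorm_sqr (R : realType) (d : nat) (v : 'rV[R]_d) :
  enorm v ^+ 2 = dot v v.
Proof.
rewrite sqr_sqrtr; last by apply: sumr_ge0 => i _; exact: sqr_ge0.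
by apply: eq_bigr => i _; rewrite expr2.
Qed.

Lemma enorm_eq0 (R : realType) (d : nat) (v : 'rV[R]_d) :
  (enorm v == 0) = (v == 0).
Proof.
apply/eqP/eqP => [v0|->]; last first.
  by rewrite /enorm big1 ?sqrtr0 // => i _; rewrite mxE expr0n.
have /eqP : dot v v = 0 by rewrite -enorm_sqr v0 expr0n.
rewrite psumr_eq0; last by move=> i _; rewrite -expr2 sqr_ge0.
move=> /allP vi; apply/rowP => i; rewrite mxE.
by have := vi i (mem_index_enum i); rewrite /= mulf_eq0 orbb => /eqP.
Qed.

Lemma enorm0 (R : realType) (d : nat) : enorm (0 : 'rV[R]_d) = 0.
Proof. by apply/eqP; rewrite enorm_eq0. Qed.

Lemma enormZ (R : realType) (d : nat) (a : R) (v : 'rV[R]_d) :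
  0 <= a -> enorm (a *: v) = a * enorm v.
Proof.
move=> a0; apply: (pexpIrn (n := 2)) => //;
  rewrite ?nnegrE ?mulr_ge0 ?enorm_ge0//.
by rewrite exprMn !enorm_sqr dotZl dotZr mulrA.
Qed.

Lemma Cauchy_Schwarz (R : realType) (d : nat) (v w : 'rV[R]_d) :
  dot v w <= enorm v * enorm w.
Proof.
have [/eqP|v0] := eqVneq (enorm v) 0.
  rewrite enorm_eq0 => /eqP ->.
  by rewrite enorm0 mul0r -(scale0r 0) dotZl mul0r.
have [/eqP|w0] := eqVneq (enorm w) 0.
  rewrite enorm_eq0 => /eqP ->.
  by rewrite enorm0 mulr0 -(scale0r 0) dotZr mul0r.
have vw0 : 0 < enorm v * enorm w by rewrite mulr_gt0 ?lt0r ?v0 ?w0 ?enorm_ge0.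
have := dotvv_ge0 (enorm w *: v - enorm v *: w).
rewrite !(dotBl, dotBr, dotZl, dotZr) -!enorm_sqr (dotC w v).
move=> h; rewrite -(ler_pM2l vw0); nra.
Qed.

Lemma enorm_pair_sqr (R : realType) (d : nat) (x : R * 'rV[R]_d) :
  enorm_pair x ^+ 2 = x.1 ^+ 2 + dot x.2 x.2.
Proof. by rewrite sqr_sqrtr ?enorm_sqr// addr_ge0 ?dotvv_ge0 ?sqr_ge0. Qed.

Lemma enorm_pair_eq0 (R : realType) (d : nat) (x : R * 'rV[R]_d) :
  enorm_pair x = 0 -> x = 0.
Proof.
case: x => a v /(congr1 (fun x => x ^+ 2)); rewrite enorm_pair_sqr expr0n /=.
move/eqP; rewrite paddr_eq0 ?sqr_ge0 ?dotvv_ge0//.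
rewrite expf_eq0 /= => /andP[/eqP -> ].
by rewrite -enorm_sqr expf_eq0 /= enorm_eq0 => /eqP ->.
Qed.

Lemma is_prox_pair (R : realType) (d : nat) (f : R * 'rV[R]_d -> \bar R)
    (x y : R * 'rV[R]_d) (c : R) :
  f y = c%:E ->
  (forall z, ((c + ((x.1 - y.1) * (z.1 - y.1)
                 + dot (x.2 - y.2) (z.2 - y.2)))%:E <= f z)%E) ->
  is_prox (@enorm_pair R d) f x y.
Proof.
apply: is_prox_subgradient; first exact: enorm_pair_eq0.
case: x y => [a u] [b v] [e w]; rewrite !enorm_pair_sqr /= !(dotBl, dotBr).
rewrite (dotC u w) (dotC v w) (dotC v u).
by field.
Qed.

Lemma is_prox_real (R : realType) (f : R -> \bar R) (x y c : R) :
  f y = c%:E -> (forall z, ((c + (x - y) * (z - y))%:E <= f z)%E) ->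
  is_prox (fun x : R => `|x|) f x y.
Proof.
apply: is_prox_subgradient => [z /eqP|z]; first by rewrite normr_eq0 => /eqP.
by rewrite !real_normK ?num_real//; field.
Qed.

(** [Phi p] dominates the linear forms [(a, b)] with [a + |b|^p / p <= 0], of
    which it is the supremum. *)
Lemma Phi_support (R : realType) (d : nat) (p : R) (hp : 1 < p) (a : R)
    (b : 'rV[R]_d) (z : R * 'rV[R]_d) :
  a + enorm b `^ p / p <= 0 -> ((a * z.1 + dot b z.2)%:E <= Phi p z)%E.
Proof.
move=> ab; rewrite /Phi; set q := p / (p - 1).
have p0 : 0 < p by lra.
have p1 : 0 < p - 1 by lra.
have q0 : 0 < q by rewrite divr_gt0.
have pq : p^-1 + q^-1 = 1 by rewrite /q; field; rewrite !gt_eqF.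
case: ifPn => [z1|z1]; last first.
  case: ifPn => [/andP[/eqP -> /eqP ->]|_]; last exact: leey.
  by rewrite mulr0 add0r -(scale0r 0) dotZr mul0r.
rewrite lee_fin.
have cs := Cauchy_Schwarz b z.2.
have zi0 : 0 <= z.1^-1 by rewrite invr_ge0 ltW.
(* The Young inequality for |b| and |z.2| / z.1, multiplied by z.1. *)
have /(ler_wpM2l (ltW z1)) := conjugate_powR (enorm_ge0 b)
  (mulr_ge0 (enorm_ge0 z.2) zi0) p0 q0 pq.
rewrite /=.
have -> : z.1 * (enorm b * (enorm z.2 / z.1)) = enorm b * enorm z.2.
  by field; rewrite gt_eqF.
rewrite powRM ?enorm_ge0//.
have zq : z.1 * (z.1^-1 `^ q) = (z.1 `^ (q - 1))^-1.
  rewrite -powR_inv1 ?ltW// -powRrM mulN1r powRN.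
  rewrite powRB ?(gt_eqF z1) ?implybT// powRr1 ?ltW// invf_div; field.
  by rewrite gt_eqF// powR_gt0.
rewrite /= mulrDr.
have -> : z.1 * (enorm z.2 `^ q * z.1^-1 `^ q / q) =
    enorm z.2 `^ q / (q * z.1 `^ (q - 1)).
  by rewrite [X in _ = _ / X]mulrC (invfM _ q) -zq; ring.
set Y := _ / (q * _) => hY.
have : z.1 * a + z.1 * (enorm b `^ p / p) <= 0.
  by rewrite -mulrDr pmulr_rle0.
lra.
Qed.

(** * Convex functions with domain the positive axis *)

(** A convex function, nowhere equal to [-oo], whose domain has interior
    the open positive axis, and which is differentiable there; its value at [0]
    may be finite or not. Lower semicontinuity is left out: it matters only at
    the origin. *)
Definition convex_on_pos (R : realType) (F : R -> \bar R) : Prop :=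
  [/\ forall x : R, F x != -oo%E, econvex F,
      (edom F)^° = [set x : R | 0 < x]
    & forall x : R, 0 < x -> derivable (fine \o F) x 1].

Lemma convex_on_pos_fin (R : realType) (F : R -> \bar R) (t : R) :
  convex_on_pos F -> 0 < t -> F t = (fine (F t))%:E.
Proof.
case=> Fp _ Fd _ t0; rewrite fineK// fin_numE Fp /=.
have : (edom F)^° t by rewrite Fd.
by move/interior_subset; rewrite /edom /= lt_neqAle => /andP[].
Qed.

Lemma convex_on_pos_lt0 (R : realType) (F : R -> \bar R) (t : R) :
  convex_on_pos F -> t < 0 -> F t = +oo%E.
Proof.
move=> HF t0; have [Fp Fc Fd _] := HF.
apply/eqP; apply: contraT => Ft.
have Ftr : F t = (fine (F t))%:E by rewrite fineK// fin_numE Fp Ft.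
(* If t < 0 is in the domain, so is the segment from t to 1. *)
suff : (edom F)^° 0 by rewrite Fd /= ltxx.
rewrite /interior /=; near=> z.
have tz : t < z by near: z; exact: lt_nbhsr.
have z1 : z < 1 by near: z; exact: lt_nbhsl.
pose l := (1 - z) / (1 - t).
have l01 : 0 < l < 1.
  rewrite /l ltr_pdivrMr ?mul1r; last lra.
  by rewrite divr_gt0 ?subr_gt0 //=; [lra|lra].
have := Fc t 1 l l01; have -> : l * t + (1 - l) * 1 = z.
  by rewrite /l; field; lra.
rewrite Ftr (convex_on_pos_fin HF ltr01) -!EFinM -EFinD /edom /=.
by move/le_lt_trans; apply; rewrite ltry.
Unshelve. all: by end_near. Qed.

(** The inequality holds for all [y], including the points where [F] is
    infinite. *)
Lemma F_above_tangent (R : realType) (F : R -> \bar R) (t y : R) :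
  convex_on_pos F -> 0 < t ->
  ((fine (F t) + ederiv F t * (y - t))%:E <= F y)%E.
Proof.
move=> HF t0; have [Fp Fc _ Fd] := HF.
have [->|Fy] := eqVneq (F y) +oo%E; first exact: leey.
have Fyr : F y = (fine (F y))%:E by rewrite fineK// fin_numE Fp Fy.
rewrite Fyr lee_fin -lerBrDl.
have df : differentiable (fine \o F) t by apply/derivable1_diffP/Fd.
have -> : ederiv F t * (y - t) = 'D_(y - t) (fine \o F) t.
  rewrite /ederiv derive1E !deriveE//.
  by rewrite -{2}(mulr1 (y - t)) -/((y - t) *: (1 : R)) linearZ /= mulrC.
have /cvg_dnbhs_at_right := @diff_derivable _ _ _ _ _ (y - t) df.
move/cvgr_to_le; apply; near=> l.
have l0 : 0 < l by near: l; exact: nbhs_right_gt.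
have l1 : l < 1 by near: l; exact: nbhs_right_lt.
have := Fc y t l; rewrite l0 l1 => /(_ isT).
have -> : l * y + (1 - l) * t = l *: (y - t) + t.
  by rewrite /GRing.scale /=; ring.
rewrite Fyr (convex_on_pos_fin HF t0) -!EFinM -EFinD /=.
set z := l *: _ + t => Fz.
have Fzr : F z = (fine (F z))%:E.
  by rewrite fineK// fin_numE Fp /=; apply: contraTneq Fz => ->.
move: Fz; rewrite Fzr lee_fin /GRing.scale /= => Fz.
by rewrite mulrC ler_pdivrMr//; lra.
Unshelve. all: by end_near. Qed.

Lemma ederiv_homo (R : realType) (F : R -> \bar R) (s t : R) :
  convex_on_pos F -> 0 < s -> s <= t -> ederiv F s <= ederiv F t.
Proof.
move=> HF s0; rewrite le_eqVlt => /orP[/eqP -> //|st].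
have t0 : 0 < t by exact: lt_trans st.
have := F_above_tangent t HF s0; have := F_above_tangent s HF t0.
rewrite (convex_on_pos_fin HF s0) (convex_on_pos_fin HF t0).
rewrite !lee_fin /= => h1 h2.
by rewrite -(ler_pM2r (_ : 0 < t - s)) ?subr_gt0//; lra.
Qed.

(** The derivative at [x] is bounded above (below) by the difference quotients
    from [x] to fixed points on its right (left), which are continuous in [x];
    the quotients to points close enough to [t] are close to the derivative
    at [t]. *)
Lemma ederiv_continuous (R : realType) (F : R -> \bar R) (t : R) :
  convex_on_pos F -> 0 < t -> {for t, continuous (ederiv F)}.
Proof.
move=> HF t0; have [_ _ _ Fd] := HF.
have cf : {for t, continuous (fine \o F)}.
  by apply/differentiable_continuous/derivable1_diffP/Fd.
have dF : h^-1 *: ((fine \o F) (h + t) - (fine \o F) t) @[h --> 0^']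
    --> ederiv F t.
  have := Fd _ t0; rewrite /derivable /ederiv derive1E /derive.
  by under eq_fun do rewrite [_ *: 1]mulr1.
have ck y : y != t ->
    (fine (F y) - fine (F x)) / (y - x) @[x --> t]
      --> (fine (F y) - fine (F t)) / (y - t).
  move=> yt; apply: cvgM; first by apply: cvgB; [exact: cvg_cst|exact: cf].
  apply: cvgV; first by rewrite subr_eq0.
  by apply: cvgB; [exact: cvg_cst|exact: cvg_id].
apply/cvgrPdist_lt => e e0.
have [y1 ty1 hy1] : exists2 y, t < y &
    (fine (F y) - fine (F t)) / (y - t) < ederiv F t + e.
  have /(cvg_dnbhs_at_right)/cvgr_lt/(_ (ederiv F t + e)) := dF.
  rewrite ltrDl => /(_ e0) H.
  near (0 : R)^'+ => h; exists (h + t).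
    by rewrite ltrDr; near: h; exact: nbhs_right_gt.
  rewrite addrK mulrC; near: h; exact: H.
have [y2 /andP[y20 ty2] hy2] : exists2 y, 0 < y < t &
    ederiv F t - e < (fine (F y) - fine (F t)) / (y - t).
  have /(cvg_dnbhs_at_left)/cvgr_gt/(_ (ederiv F t - e)) := dF.
  rewrite gtrBl => /(_ e0) H.
  near (0 : R)^'- => h; exists (h + t).
    apply/andP; split; last by rewrite gtrDr; near: h; exact: nbhs_left_lt.
    have : - t < h by near: h; apply: nbhs_left_gt; rewrite oppr_lt0.
    lra.
  rewrite addrK mulrC; near: h; exact: H.
have y1t : y1 != t by rewrite gt_eqF.
have y2t : y2 != t by rewrite lt_eqF.
have /cvgr_lt/(_ _ hy1) H1 := ck _ y1t.
have /cvgr_gt/(_ _ hy2) H2 := ck _ y2t.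
near=> x.
have xy1 : x < y1 by near: x; exact: lt_nbhsl.
have xy2 : y2 < x by near: x; exact: lt_nbhsr.
have x0 : 0 < x by exact: lt_trans xy2.
have h1 : (fine (F y1) - fine (F x)) / (y1 - x) < ederiv F t + e.
  by near: x; exact: H1.
have h2 : ederiv F t - e < (fine (F y2) - fine (F x)) / (y2 - x).
  by near: x; exact: H2.
have := F_above_tangent y1 HF x0; have := F_above_tangent y2 HF x0.
rewrite (convex_on_pos_fin HF y20) (convex_on_pos_fin HF (lt_trans t0 ty1)).
rewrite !lee_fin => g2 g1.
move: h1 h2; rewrite ltr_pdivrMr ?subr_gt0// ltr_ndivlMr ?subr_lt0// => h1 h2.
rewrite ltr_norml; apply/andP; split.
  rewrite ltrBrDr -ltrBrDl -(ltr_pM2r (_ : 0 < y1 - x)) ?subr_gt0//; lra.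
rewrite ltrBlDr -ltrBlDl -(ltr_pM2r (_ : 0 < x - y2)) ?subr_gt0//; lra.
Unshelve. all: by end_near. Qed.

(** The analogue of [F_above_tangent] at the boundary point, with the limit [l]
    of the derivative as slope. *)
Lemma F_above_tangent0 (R : realType) (F : R -> \bar R) (l y : R) :
  convex_on_pos F -> lower_semicontinuous F ->
  (ederiv F xi)%:E @[xi --> 0^'+] --> l%:E ->
  (F 0%R + (l * y)%:E <= F y)%E.
Proof.
move=> HF Fl gl; have [Fp _ _ _] := HF.
have [y0|] := ltP y 0; first by rewrite (convex_on_pos_lt0 HF y0) leey.
rewrite le_eqVlt => /predU1P[<-|y0]; first by rewrite mulr0 adde0.
have gl' : ederiv F xi @[xi --> 0^'+] --> l by exact: (fine_cvg gl).
have lg t : 0 < t -> l <= ederiv F t.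
  move=> t0; apply: cvgr_to_le gl' _; near=> x.
  by apply: ederiv_homo => //; near: x; exact: nbhs_right_ltW.
rewrite -leeBrDr// leNgt (convex_on_pos_fin HF y0) -EFinB; apply/negP => F0.
(* A level a strictly between F(y) - l y and F(0), to use semicontinuity. *)
have [a ca aF0] : exists2 a : R, fine (F y) - l * y < a & (a%:E < F 0%R)%E.
  case: (F 0%R) F0 => [c| |//]; last first.
    by exists (fine (F y) - l * y + 1); rewrite ?ltrDl ?ltry.
  rewrite lte_fin => /midf_lt [h1 h2]; eexists; first exact: h1.
  by rewrite lte_fin.
have [V V0 aV] := Fl _ _ aF0.
have H : (a + l * (y - x)) @[x --> 0^'+] --> a + l * (y - 0).
  apply: cvg_at_right_filter; apply: cvgD; first exact: cvg_cst.
  apply: cvgM; first exact: cvg_cst.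
  by apply: cvgB; [exact: cvg_cst|exact: cvg_id].
have /cvgr_gt/(_ (fine (F y))) := H; rewrite subr0 -ltrBlDr => /(_ ca) {}H.
near (0 : R)^'+ => t.
have t0 : 0 < t by near: t; exact: nbhs_right_gt.
have ty : t < y by near: t; exact: nbhs_right_lt.
have : (a%:E < F t)%E by apply: aV; near: t; exact: cvg_within V0.
have h : fine (F y) < a + l * (y - t) by near: t; exact: H.
have := F_above_tangent y HF t0.
rewrite (convex_on_pos_fin HF t0) (convex_on_pos_fin HF y0).
rewrite lee_fin lte_fin /= => h1 h2.
have : l * (y - t) <= ederiv F t * (y - t) by rewrite ler_pM2r ?subr_gt0// lg.
lra.
Unshelve. all: by end_near. Qed.

(** * The functions s and R *)

Lemma powRK (R : realType) (p x : R) : 0 < p -> 0 <= x ->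
  (x `^ (1 / p)) `^ p = x.
Proof. by move=> p0 x0; rewrite -powRrM div1r mulVf ?gt_eqF// powRr1. Qed.

(** The positive part is needed since the power of a negative real is [1] by
    convention. *)
Lemma continuous_powR_max0 (R : realType) (a : R) : 0 < a ->
  continuous (fun x : R => (Num.max 0 x) `^ a).
Proof.
move=> a0 x; apply/cvgrPdist_lt => e e0.
have [x0|] := ltP 0 x.
  have /derivable1_diffP/differentiable_continuous cx :
      derivable (@powR R ^~ a) x 1.
    by apply: derivable_powR; rewrite in_itv /= andbT.
  have /cvgrPdist_lt/(_ e e0) H := cx.
  near=> y.
  have y0 : 0 < y by near: y; exact: lt_nbhsr.
  rewrite /= !max_r ?ltW//; near: y; exact: H.
move=> x0; rewrite powR0 ?gt_eqF//.
have d0 : 0 < e `^ (1 / a) by exact: powR_gt0.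
near=> y.
have yd : y < e `^ (1 / a) by near: y; apply: lt_nbhsl; exact: le_lt_trans d0.
rewrite sub0r normrN ger0_norm ?powR_ge0// -[ltRHS](powRK a0 (ltW e0)).
apply: gt0_ltr_powR => //; rewrite ?nnegrE ?le_max ?lexx ?(ltW d0)//.
by rewrite gt_max d0.
Unshelve. all: by end_near. Qed.

Lemma cvg_powR_max0 (R : realType) (a : R) (T : Type) (G : set_system T)
    (FG : Filter G) (u : T -> R) (t : R) :
  0 < a -> u @ G --> t ->
  (Num.max 0 (u x)) `^ a @[x --> G] --> (Num.max 0 t) `^ a.
Proof.
move=> a0 ut.
exact: (@continuous_cvg _ _ _ _ _ _ (fun x : R => (Num.max 0 x) `^ a)
  _ (continuous_powR_max0 a0 (x:=t)) ut).
Qed.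

(** The slack [s(t) = t + gamma F'(t) - rho] grows at least as fast as [t]. *)
Lemma slack_grow (R : realType) (F : R -> \bar R) (gamma rho s t : R) :
  convex_on_pos F -> 0 <= gamma -> 0 < s -> s <= t ->
  slack F gamma rho s + (t - s) <= slack F gamma rho t.
Proof.
move=> HF g0 s0 st; have := ler_wpM2l g0 (ederiv_homo HF s0 st).
by rewrite /slack; lra.
Qed.

Lemma slack_continuous (R : realType) (F : R -> \bar R) (gamma rho t : R) :
  convex_on_pos F -> 0 < t -> {for t, continuous (slack F gamma rho)}.
Proof.
move=> HF t0; apply: cvgB; last exact: cvg_cst.
apply: cvgD; first exact: cvg_id.
by apply: cvgM; [exact: cvg_cst|exact: ederiv_continuous].
Qed.

(** The expression of [Rfun] as a function of [t] and of the slack [s], with [K]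
    the term in [m], made continuous on the whole plane by replacing the bases
    of the powers of [s], and of the outer power, by their positive parts. *)
Definition Rext (R : realType) (p gamma K t s : R) : R :=
  (Num.max 0 (gamma * (Num.max 0 s) `^ (1 / p) +
    t * (p / gamma) `^ (1 - 2 / p) * (Num.max 0 s) `^ (1 - 1 / p))) `^ p - K.

Lemma invp_lt1 (R : realType) (p : R) : 1 < p -> 0 < 1 - 1 / p.
Proof. by move=> p1; rewrite subr_gt0 ltr_pdivrMr ?mul1r//; lra. Qed.

Lemma Rext_cvg (R : realType) (p gamma K : R) (T : Type) (G : set_system T)
    (FG : Filter G) (u v : T -> R) (t s : R) :
  1 < p -> u @ G --> t -> v @ G --> s ->
  Rext p gamma K (u x) (v x) @[x --> G] --> Rext p gamma K t s.
Proof.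
move=> p1 ut vs; have p0 : 0 < p by lra.
apply: cvgB; last exact: cvg_cst.
apply: cvg_powR_max0 => //; apply: cvgD.
  apply: cvgM; first exact: cvg_cst.
  by apply: cvg_powR_max0 => //; rewrite divr_gt0.
apply: cvgM; first by apply: cvgM => //; exact: cvg_cst.
by apply: cvg_powR_max0 => //; exact: invp_lt1.
Qed.

Lemma RfunE (R : realType) (d : nat) (F : R -> \bar R) (p gamma rho : R)
    (m : 'rV[R]_d) (t : R) :
  0 <= gamma -> 0 <= t -> 0 <= slack F gamma rho t ->
  Rfun F p gamma rho m t =
  Rext p gamma (gamma * enorm m `^ p / p) t (slack F gamma rho t).
Proof.
move=> g0 t0 s0; rewrite /Rfun /Rext !max_r//.
by rewrite addr_ge0 // !mulr_ge0// powR_ge0.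
Qed.

Lemma Rfun_ge (R : realType) (d : nat) (F : R -> \bar R) (p gamma rho : R)
    (m : 'rV[R]_d) (t : R) :
  1 < p -> 0 <= gamma -> 0 <= t -> 0 <= slack F gamma rho t ->
  gamma `^ p * slack F gamma rho t - gamma * enorm m `^ p / p
    <= Rfun F p gamma rho m t.
Proof.
move=> p1 g0 t0 s0; have p0 : 0 < p by lra.
rewrite /Rfun lerD2r -[X in _ * X](powRK p0 s0) -powRM ?powR_ge0//.
have h1 : 0 <= gamma * slack F gamma rho t `^ (1 / p).
  exact: mulr_ge0 g0 (powR_ge0 _ _).
have h2 : 0 <= t * (p / gamma) `^ (1 - 2 / p)
    * slack F gamma rho t `^ (1 - 1 / p).
  exact: mulr_ge0 (mulr_ge0 t0 (powR_ge0 _ _)) (powR_ge0 _ _).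
apply: ge0_ler_powR; rewrite ?nnegrE ?lerDl//; first exact: ltW.
exact: addr_ge0.
Qed.

Lemma Rfun_lt (R : realType) (d : nat) (F : R -> \bar R) (p gamma rho : R)
    (m : 'rV[R]_d) (t1 t2 : R) :
  convex_on_pos F -> 1 < p -> 0 < gamma -> 0 < t1 -> t1 < t2 ->
  0 <= slack F gamma rho t1 ->
  Rfun F p gamma rho m t1 < Rfun F p gamma rho m t2.
Proof.
move=> HF p1 g0 t10 t12 s1; have p0 : 0 < p by lra.
have s12 : slack F gamma rho t1 < slack F gamma rho t2.
  by have := slack_grow rho HF (ltW g0) t10 (ltW t12); lra.
have s2 := le_trans s1 (ltW s12).
have t20 := lt_trans t10 t12.
rewrite /Rfun ltrD2r gt0_ltr_powR// ?nnegrE.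
- by rewrite addr_ge0 // !mulr_ge0 ?powR_ge0// ltW.
- by rewrite addr_ge0 // !mulr_ge0 ?powR_ge0// ltW.
apply: ltr_leD; first by rewrite ltr_pM2l// gt0_ltr_powR ?nnegrE ?divr_gt0.
have h1 : t1 * (p / gamma) `^ (1 - 2 / p) <= t2 * (p / gamma) `^ (1 - 2 / p).
  exact: ler_wpM2r (powR_ge0 _ _) _ _ (ltW t12).
have h2 : slack F gamma rho t1 `^ (1 - 1 / p)
    <= slack F gamma rho t2 `^ (1 - 1 / p).
  exact: (ge0_ler_powR (ltW (invp_lt1 p1)) s1 s2 (ltW s12)).
have h3 : 0 <= t1 * (p / gamma) `^ (1 - 2 / p).
  exact: mulr_ge0 (ltW t10) (powR_ge0 _ _).
exact: ler_pM h3 (powR_ge0 _ _) h1 h2.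
Qed.

Lemma Rfun_root (R : realType) (d : nat) (F : R -> \bar R) (p gamma rho : R)
    (m : 'rV[R]_d) (a : R) :
  convex_on_pos F -> 1 < p -> 0 < gamma -> 0 < a ->
  0 <= slack F gamma rho a -> Rfun F p gamma rho m a <= 0 ->
  exists2 t, a <= t & Rfun F p gamma rho m t = 0.
Proof.
move=> HF p1 g0 a0 sa Ra; have p0 : 0 < p by lra.
set K := gamma * enorm m `^ p / p.
have K0 : 0 <= K by rewrite /K divr_ge0 ?mulr_ge0 ?powR_ge0// ltW.
have gp : 0 < gamma `^ p by exact: powR_gt0.
(* s (b) >= K / gamma ^ p, hence R (b) >= 0 by Rfun_ge. *)
pose b := a + K / gamma `^ p.
have ab : a <= b by rewrite lerDl divr_ge0// ltW.
have s_ge0 t : a <= t -> 0 <= slack F gamma rho t.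
  by move=> at_; have := slack_grow rho HF (ltW g0) a0 at_; lra.
have Rb : 0 <= Rfun F p gamma rho m b.
  have b0 : 0 <= b by exact: le_trans (ltW a0) ab.
  apply: le_trans (Rfun_ge m p1 (ltW g0) b0 (s_ge0 _ ab)).
  rewrite -/K subr_ge0 mulrC -ler_pdivrMr//.
  by have := slack_grow rho HF (ltW g0) a0 ab; rewrite /b; lra.
have RE t : a <= t -> Rfun F p gamma rho m t
    = Rext p gamma K t (slack F gamma rho t).
  by move=> at_; rewrite RfunE ?s_ge0 ?(ltW g0)// (le_trans (ltW a0)).
have [||t tab Rt] := @IVT R
    (fun t => Rext p gamma K t (slack F gamma rho t)) a b 0 ab.
- apply: continuous_in_subspaceT => t /set_mem /=.
  rewrite in_itv /= => /andP[at_ _].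
  apply: Rext_cvg => //.
  by apply: slack_continuous => //; exact: lt_le_trans at_.
- move: Ra Rb; rewrite (RE a (lexx _)) (RE b ab).
  move: (Rext _ _ _ a _) (Rext _ _ _ b _) => ra rb Ra Rb.
  by rewrite ge_min le_max Ra Rb orbT.
move: tab; rewrite in_itv /= => /andP[at_ _].
by exists t => //; rewrite RE.
Qed.

(** * Subgradients of F and of the sum of Phi and F *)

Lemma scaled_sum_ge (R : realType) (c a b : R) (X Y : \bar R) :
  0 <= c -> (a%:E <= X)%E -> (b%:E <= Y)%E ->
  ((c * (a + b))%:E <= c%:E * (X + Y))%E.
Proof.
move=> c0 aX bY; rewrite EFinM; apply: lee_wpmul2l; first by rewrite lee_fin.
by rewrite EFinD; exact: leeD.
Qed.

Lemma convex_on_pos_fin0 (R : realType) (F : R -> \bar R) (l : R) :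
  convex_on_pos F -> lower_semicontinuous F ->
  (ederiv F xi)%:E @[xi --> 0^'+] --> l%:E -> F 0%R = (fine (F 0%R))%:E.
Proof.
move=> HF Fl gl; have [Fp _ _ _] := HF; rewrite fineK// fin_numE Fp /=.
have := F_above_tangent0 1 HF Fl gl; rewrite (convex_on_pos_fin HF ltr01).
by apply: contraTneq => ->.
Qed.

Lemma prox_F_origin (R : realType) (F : R -> \bar R) (l gamma rho : R) :
  convex_on_pos F -> lower_semicontinuous F ->
  (ederiv F xi)%:E @[xi --> 0^'+] --> l%:E ->
  0 < gamma -> rho <= gamma * l ->
  is_prox (fun x : R => `|x|) (fun x => (gamma%:E * F x)%E) rho 0.
Proof.
move=> HF Fl gl g0 rl; have F0 := convex_on_pos_fin0 HF Fl gl.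
apply: (@is_prox_real _ _ _ _ (gamma * fine (F 0%R))).
  by rewrite F0 -EFinM.
move=> z; rewrite !subr0.
have [z0|z0] := ltP z 0.
  by rewrite (convex_on_pos_lt0 HF z0) gt0_muley ?lte_fin// leey.
apply: (@le_trans _ _ (gamma%:E * (fine (F 0%R) + l * z)%:E)%E).
  by rewrite -EFinM lee_fin; have := ler_wpM2r z0 rl; lra.
apply: lee_wpmul2l; first by rewrite lee_fin ltW.
by have := F_above_tangent0 z HF Fl gl; rewrite {1}F0.
Qed.

Lemma prox_F_pos (R : realType) (F : R -> \bar R) (gamma rho r : R) :
  convex_on_pos F -> 0 < gamma -> 0 < r -> slack F gamma rho r = 0 ->
  is_prox (fun x : R => `|x|) (fun x => (gamma%:E * F x)%E) rho r.
Proof.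
move=> HF g0 r0 s0.
apply: (@is_prox_real _ _ _ _ (gamma * fine (F r))).
  by rewrite {1}(convex_on_pos_fin HF r0) -EFinM.
move=> z; have -> : rho - r = gamma * ederiv F r.
  by move: s0; rewrite /slack; lra.
rewrite -mulrA -mulrDr EFinM; apply: lee_wpmul2l; first by rewrite lee_fin ltW.
exact: F_above_tangent.
Qed.

Lemma slack_root (R : realType) (F : R -> \bar R) (L0 : \bar R)
    (gamma rho : R) :
  convex_on_pos F -> (ederiv F xi)%:E @[xi --> 0^'+] --> L0 -> 0 < gamma ->
  (gamma%:E * L0 < rho%:E)%E -> exists2 r, 0 < r & slack F gamma rho r = 0.
Proof.
move=> HF gL g0 gLr.
(* A slope c above L0 that still makes the slack negative close to 0. *)
have [c cr gc] : exists2 c, gamma * c < rho &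
    \forall t \near (0 : R)^'+, ederiv F t < c.
  case: L0 gL gLr => [l| |] gL.
  - rewrite -EFinM lte_fin mulrC -ltr_pdivlMr// => /midf_lt [lc cr].
    exists ((l + rho / gamma) / 2); first by rewrite mulrC -ltr_pdivlMr.
    have gl : ederiv F xi @[xi --> 0^'+] --> l by exact: (fine_cvg gL).
    by move/cvgr_lt : gl => /(_ _ lc).
  - by rewrite gt0_muley ?lte_fin.
  - move=> _; exists (rho / gamma - 1).
      by rewrite mulrBr mulr1 mulrC divfK ?gt_eqF// ltrBlDr ltrDl.
    by move/cvgeNyPlt : gL => /(_ (rho / gamma - 1)); apply: filterS.
have [a a0 sa] : exists2 a, 0 < a & slack F gamma rho a <= 0.
  near (0 : R)^'+ => t; exists t; first by near: t; exact: nbhs_right_gt.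
  have : t < rho - gamma * c by near: t; apply: nbhs_right_lt; rewrite subr_gt0.
  have : ederiv F t < c by near: t.
  by rewrite -(ltr_pM2l g0) /slack; lra.
(* By slack_grow the slack is nonnegative at b. *)
pose b := a - slack F gamma rho a.
have ab : a <= b by rewrite lerBrDr gerDl.
have sb : 0 <= slack F gamma rho b.
  by have := slack_grow rho HF (ltW g0) a0 ab; rewrite /b; lra.
have [||r + rs] := @IVT R (slack F gamma rho) a b 0 ab.
- apply: continuous_in_subspaceT => t /set_mem /=; rewrite in_itv /=.
  by move=> /andP[at_ _]; apply: slack_continuous => //; exact: lt_le_trans at_.
- by rewrite ge_min le_max sa sb orbT.
by rewrite in_itv /= => /andP[ar _]; exists r => //; exact: lt_le_trans ar.
Unshelve. all: by end_near. Qed.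

Lemma prox_origin (R : realType) (d : nat) (F : R -> \bar R) (l p gamma rho : R)
    (m : 'rV[R]_d) :
  convex_on_pos F -> lower_semicontinuous F ->
  (ederiv F xi)%:E @[xi --> 0^'+] --> l%:E -> 1 < p -> 0 < gamma ->
  rho + enorm m `^ p / (p * gamma `^ (p - 1)) <= gamma * l ->
  is_prox (@enorm_pair R d)
    (fun x => (gamma%:E * (Phi p x + Psi F x))%E) (rho, m) (0, 0).
Proof.
move=> HF Fl gl p1 g0 hl; have F0 := convex_on_pos_fin0 HF Fl gl.
have p0 : 0 < p by lra.
apply: (@is_prox_pair _ _ _ _ _ (gamma * fine (F 0%R))) => /=.
  by rewrite /Phi /Psi /= ltxx !eqxx /= add0e {1}F0 -EFinM.
case=> z1 z2 /=; rewrite !subr0.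
have [z0|z0] := ltP z1 0.
  rewrite /Psi /= (convex_on_pos_lt0 HF z0) addey ?gt0_muley ?lte_fin ?leey//.
  by rewrite /Phi /= ltNge (ltW z0) /= (lt_eqF z0).
pose b := gamma^-1 *: m; pose a := - (enorm b `^ p / p).
have hF : ((fine (F 0%R) + l * z1)%:E <= Psi F (z1, z2))%E.
  by have := F_above_tangent0 z1 HF Fl gl; rewrite {1}F0.
have hP : ((a * z1 + dot b z2)%:E <= Phi p (z1, z2))%E.
  by apply: (@Phi_support _ _ _ p1 a b (z1, z2)); rewrite /a addNr.
apply: le_trans (scaled_sum_ge (ltW g0) hP hF); rewrite lee_fin /b dotZl.
have ga : gamma * a = - (enorm m `^ p / (p * gamma `^ (p - 1))).
  rewrite /a /b enormZ ?invr_ge0 ?ltW// powRM ?invr_ge0 ?enorm_ge0 ?ltW//.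
  rewrite -powR_inv1 ?ltW// -powRrM mulN1r powRN -(mulr_powRB1 (ltW g0) p0).
  by field; rewrite !gt_eqF ?powR_gt0.
have h : rho * z1 <= gamma * (a + l) * z1.
  by apply: ler_wpM2r => //; lra.
have -> : gamma * (a * z1 + gamma^-1 * dot m z2 + (fine (F 0%R) + l * z1)) =
  gamma * (a + l) * z1 + gamma * fine (F 0%R) + dot m z2.
  by field; rewrite gt_eqF.
lra.
Qed.

(** Here [u] is the ratio [|v| / theta] at the proximal point [(theta, v)], in
    terms of which the optimality conditions read as the two equations on the
    slack and on [|m|]. *)
Lemma prox_pos (R : realType) (d : nat) (F : R -> \bar R)
    (p gamma rho theta u : R) (m : 'rV[R]_d) :
  let q := p / (p - 1) in
  convex_on_pos F -> 1 < p -> 0 < gamma -> 0 < theta -> 0 <= u ->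
  slack F gamma rho theta = gamma * u `^ q / p ->
  gamma * u `^ (q - 1) + theta * u = enorm m ->
  is_prox (@enorm_pair R d)
    (fun x => (gamma%:E * (Phi p x + Psi F x))%E) (rho, m)
    (theta, (theta * u / enorm m) *: m).
Proof.
move=> q HF p1 g0 t0 u0 sE mE.
have p0 : 0 < p by lra.
have pm0 : 0 < p - 1 by lra.
have q0 : 0 < q by rewrite divr_gt0.
have q1 : q - 1 = (p - 1)^-1 by rewrite /q; field; lra.
have n0 := enorm_ge0 m.
set w := u `^ (q - 1) in mE; have w0 : 0 <= w := powR_ge0 _ _.
have tu0 : 0 <= theta * u by rewrite mulr_ge0// ltW.
have gw0 : 0 <= gamma * w by rewrite mulr_ge0// ltW.
have uw : u * w = u `^ q by rewrite mulr_powRB1.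
have wp : w `^ p = u `^ q.
  by rewrite -powRrM q1; congr (_ `^ _); rewrite /q mulrC.
(* If m = 0 then u = w = 0, so that dividing by |m| = 0 is harmless. *)
have divn x : (enorm m = 0 -> x = 0) -> x / enorm m * enorm m = x.
  have [e0 /(_ e0) ->|ne0 _] := eqVneq (enorm m) 0; first by rewrite !mul0r.
  by rewrite divfK.
have wn : w / enorm m * enorm m = w.
  apply: divn => e0; apply/eqP; rewrite -(mulrI_eq0 _ (lregP (lt0r_neq0 g0))).
  by apply/eqP; lra.
have un : theta * u / enorm m * enorm m = theta * u.
  by apply: divn => e0; lra.
set b := (w / enorm m) *: m; set v := (_ / _) *: m.
have bn : enorm b = w by rewrite enormZ ?divr_ge0.
have vn : enorm v = theta * u by rewrite enormZ ?divr_ge0.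
have bv : dot b v = theta * u `^ q.
  rewrite dotZl dotZr -enorm_sqr -uw.
  have -> : theta * (u * w) =
      (w / enorm m * enorm m) * (theta * u / enorm m * enorm m).
    by rewrite wn un; ring.
  by ring.
have mv : m - v = gamma *: b.
  apply/eqP; rewrite subr_eq /b /v scalerA -scalerDl.
  have [->|mn0] := eqVneq m 0; first by rewrite scaler0.
  by rewrite mulrA -mulrDl mE divff ?scale1r// enorm_eq0.
pose c := gamma * (theta * u `^ q / q + fine (F theta)).
apply: (@is_prox_pair _ _ _ _ _ c) => /=.
  rewrite /Phi /Psi /= t0 {1}(convex_on_pos_fin HF t0) -EFinD -EFinM.
  congr (_ * (_ + _))%:E.
  rewrite vn powRM ?(ltW t0)// -/q -(mulr_powRB1 (ltW t0) q0).
  by field; rewrite !gt_eqF ?powR_gt0.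
case=> z1 z2 /=; pose a := - (u `^ q / p).
have hP : ((a * z1 + dot b z2)%:E <= Phi p (z1, z2))%E.
  by apply: (@Phi_support _ _ _ p1 a b (z1, z2)); rewrite /a bn wp addNr.
have hF := F_above_tangent z1 HF t0.
apply: le_trans (scaled_sum_ge (ltW g0) hP hF); rewrite lee_fin mv.
rewrite dotZl dotBr bv /c /a.
have -> : rho - theta = gamma * ederiv F theta - gamma * u `^ q / p.
  by rewrite -sE /slack; ring.
rewrite le_eqVlt; apply/orP; left; apply/eqP; rewrite /q; field.
by rewrite !gt_eqF.
Qed.

(** * The proximal point attached to a root of R *)

(** The equation [R(t) = 0] is [gamma w + t u = |m|] multiplied by
    [(gamma / p)^(1/p)] and raised to the power [p], where [w = sigma^(1/p)] and
    [u = sigma^(1 - 1/p)]. *)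
Lemma Rfun_eq0 (R : realType) (d : nat) (F : R -> \bar R) (p gamma rho : R)
    (m : 'rV[R]_d) (t : R) :
  let sigma := p * slack F gamma rho t / gamma in
  1 < p -> 0 < gamma -> 0 <= t -> 0 <= slack F gamma rho t ->
  Rfun F p gamma rho m t = 0 ->
  gamma * sigma `^ (1 / p) + t * sigma `^ (1 - 1 / p) = enorm m.
Proof.
move=> sigma p1 g0 t0 s0; have p0 : 0 < p by lra.
have k0 : 0 < gamma / p by rewrite divr_gt0.
have sg0 : 0 <= sigma by rewrite !mulr_ge0 ?invr_ge0// ltW.
have sE : slack F gamma rho t = gamma / p * sigma.
  by rewrite /sigma; field; rewrite !gt_eqF.
rewrite /Rfun sE !(powRM _ (ltW k0) sg0).
have -> : p / gamma = (gamma / p) `^ (-1) by rewrite powR_inv1 ?ltW// invf_div.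
rewrite -powRrM.
set w := sigma `^ (1 / p); set u := sigma `^ (1 - 1 / p).
have -> : gamma * ((gamma / p) `^ (1 / p) * w) +
    t * (gamma / p) `^ (-1 * (1 - 2 / p)) * ((gamma / p) `^ (1 - 1 / p) * u) =
    (gamma / p) `^ (1 / p) * (gamma * w + t * u).
  have -> : (gamma / p) `^ (1 / p) =
      (gamma / p) `^ (-1 * (1 - 2 / p)) * (gamma / p) `^ (1 - 1 / p).
    rewrite -powRD ?(gt_eqF k0) ?implybT//; congr (_ `^ _).
    by field; rewrite gt_eqF.
  by ring.
have Y0 : 0 <= gamma * w + t * u.
  by apply: addr_ge0; apply: mulr_ge0; rewrite ?powR_ge0// ltW.
rewrite powRM ?powR_ge0// powRK ?(ltW k0)// => H.
apply: (powR_injective p0); rewrite ?nnegrE ?enorm_ge0//.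
apply: (mulfI (lt0r_neq0 k0)); apply/eqP; rewrite -subr_eq0; apply/eqP.
by rewrite -[RHS]H; ring.
Qed.

Lemma vsolE (R : realType) (d : nat) (F : R -> \bar R) (p gamma rho : R)
    (m : 'rV[R]_d) (t : R) :
  let sigma := p * slack F gamma rho t / gamma in
  1 < p -> 0 < gamma -> 0 < t -> 0 <= slack F gamma rho t ->
  gamma * sigma `^ (1 / p) + t * sigma `^ (1 - 1 / p) = enorm m ->
  vsol F p gamma rho m t = (t * sigma `^ (1 - 1 / p) / enorm m) *: m.
Proof.
move=> sigma p1 g0 t0 s0 mE; have p0 : 0 < p by lra.
rewrite /vsol; case: eqVneq => [->|m0]; first by rewrite scaler0.
have sg0 : 0 <= sigma by rewrite !mulr_ge0 ?invr_ge0// ltW.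
have sg : 0 < sigma.
  rewrite lt0r sg0 andbT; apply: contraNneq m0 => sg.
  rewrite -enorm_eq0 -mE sg !powR0 ?mulr0 ?addr0//.
    by rewrite gt_eqF// invp_lt1.
  by rewrite gt_eqF// divr_gt0.
congr (_ *: _); rewrite -mE.
have -> : 2 / (p / (p - 1)) = 2 * (1 - 1 / p) by field; lra.
set e := 1 - 2 * (1 - 1 / p).
have -> : gamma `^ (2 * (1 - 1 / p)) * p `^ e * slack F gamma rho t `^ e =
    gamma * (sigma `^ (1 / p) / sigma `^ (1 - 1 / p)).
  have -> : slack F gamma rho t = gamma / p * sigma.
    by rewrite /sigma; field; rewrite !gt_eqF.
  rewrite -mulrA -powRM ?(ltW p0) ?mulr_ge0 ?invr_ge0 ?(ltW p0) ?(ltW g0)//.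
  have -> : p * (gamma / p * sigma) = gamma * sigma.
    by field; rewrite gt_eqF.
  rewrite powRM ?(ltW g0)// mulrA -powRD ?(gt_eqF g0) ?implybT//.
  rewrite subrKC powRr1 ?(ltW g0)//; congr (_ * _).
  rewrite -powRB ?(gt_eqF sg) ?implybT//; congr (_ `^ _).
  by rewrite /e; field; rewrite gt_eqF.
have u0 : 0 < sigma `^ (1 - 1 / p) by exact: powR_gt0.
have w0 : 0 < sigma `^ (1 / p) by exact: powR_gt0.
move: (sigma `^ (1 - 1 / p)) (sigma `^ (1 / p)) u0 w0 => u w u0 w0.
have h : 0 < gamma * w + t * u by rewrite addr_gt0// mulr_gt0.
by field; rewrite !gt_eqF.
Qed.

Lemma prox_root (R : realType) (d : nat) (F : R -> \bar R) (p gamma rho : R)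
    (m : 'rV[R]_d) (t : R) :
  convex_on_pos F -> 1 < p -> 0 < gamma -> 0 < t ->
  0 <= slack F gamma rho t -> Rfun F p gamma rho m t = 0 ->
  is_prox (@enorm_pair R d)
    (fun x => (gamma%:E * (Phi p x + Psi F x))%E) (rho, m)
    (t, vsol F p gamma rho m t).
Proof.
move=> HF p1 g0 t0 s0 Rt; have p0 : 0 < p by lra.
have mE := Rfun_eq0 p1 g0 (ltW t0) s0 Rt.
rewrite (vsolE p1 g0 t0 s0 mE).
set sigma := p * slack F gamma rho t / gamma in mE *.
have sg0 : 0 <= sigma by rewrite !mulr_ge0 ?invr_ge0// ltW.
apply: prox_pos => //; first exact: powR_ge0.
  rewrite -powRrM; have -> : (1 - 1 / p) * (p / (p - 1)) = 1 by field; lra.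
  by rewrite powRr1// /sigma; field; rewrite !gt_eqF.
rewrite -powRrM.
by have -> : (1 - 1 / p) * (p / (p - 1) - 1) = 1 / p by field; lra.
Qed.

(** The proximal point [r] of [gamma F] at [rho], together with a point [a >= r]
    from which the search for a root of [R] can start: [a = r] if [r > 0], and
    a point close to [0] otherwise. *)
Lemma prox_F_and_Rfun_le0 (R : realType) (d : nat) (F : R -> \bar R)
    (L0 : \bar R) (p gamma rho : R) (m : 'rV[R]_d) :
  convex_on_pos F -> lower_semicontinuous F ->
  (ederiv F xi)%:E @[xi --> 0^'+] --> L0 -> L0 != +oo%E ->
  1 < p -> 0 < gamma ->
  (gamma%:E * L0 <
     (rho + enorm m `^ p / (p * gamma `^ (p - 1)))%:E)%E ->
  exists r a : R,
    [/\ is_prox (fun x : R => `|x|) (fun x => (gamma%:E * F x)%E) rho r,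
        0 <= r /\ (forall t, 0 < t -> r <= t -> 0 <= slack F gamma rho t),
        0 < a, r <= a & Rfun F p gamma rho m a <= 0].
Proof.
move=> HF Fl gL L0y p1 g0 gLl; have p0 : 0 < p by lra.
have [gLr|] := ltP (gamma%:E * L0)%E rho%:E.
  have [r r0 sr] := slack_root HF gL g0 gLr.
  exists r, r; split => //; first exact: prox_F_pos.
    split; first exact: ltW.
    by move=> t _ rt; have := slack_grow rho HF (ltW g0) r0 rt; lra.
  rewrite /Rfun sr !powR0 ?(gt_eqF p0) ?(gt_eqF (invp_lt1 p1))//; last first.
    by rewrite gt_eqF// divr_gt0.
  rewrite !mulr0 addr0 powR0 ?gt_eqF// sub0r oppr_le0.
  by rewrite divr_ge0 ?mulr_ge0 ?powR_ge0// ltW.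
case: L0 L0y gL gLl => [l| |] // _ gL; last first.
  by rewrite gt0_muleNy ?lte_fin.
rewrite -EFinM lee_fin lte_fin => gLl rl.
have gl : ederiv F xi @[xi --> 0^'+] --> l by exact: (fine_cvg gL).
have s_ge0 t : 0 < t -> 0 <= slack F gamma rho t.
  move=> t0; have : l <= ederiv F t.
    apply: cvgr_to_le gl _; near=> x.
    by apply: ederiv_homo => //; near: x; exact: nbhs_right_ltW.
  by rewrite -(ler_pM2l g0) /slack; lra.
have sl : slack F gamma rho x @[x --> 0^'+] --> 0 + gamma * l - rho.
  apply: cvgB; last exact: cvg_cst.
  apply: cvgD; first by apply: cvg_at_right_filter; exact: cvg_id.
  by apply: cvgM => //; exact: cvg_cst.
(* This is the strict inequality in the hypothesis, times gamma ^ p. *)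
have R0 : Rext p gamma (gamma * enorm m `^ p / p) 0 (0 + gamma * l - rho) < 0.
  rewrite /Rext add0r !mul0r addr0.
  rewrite [Num.max 0 (gamma * l - rho)]max_r ?subr_ge0//.
  rewrite max_r ?mulr_ge0 ?powR_ge0 ?(ltW g0)// powRM ?powR_ge0 ?(ltW g0)//.
  rewrite powRK ?subr_ge0// subr_lt0 -(mulr_powRB1 (ltW g0) p0) -!mulrA.
  rewrite ltr_pM2l// -ltr_pdivlMl ?powR_gt0//.
  move: gLl; rewrite invfM; lra.
have t0 : x @[x --> 0^'+] --> (0 : R).
  by apply: cvg_at_right_filter; exact: cvg_id.
have /cvgr_lt/(_ _ R0) H := Rext_cvg (gamma := gamma)
  (K := gamma * enorm m `^ p / p) (@at_right_proper_filter R 0) p1 t0 sl.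
near (0 : R)^'+ => a.
have a0 : 0 < a by near: a; exact: nbhs_right_gt.
exists 0, a; split; rewrite ?(ltW a0)//.
- exact: prox_F_origin gL g0 rl.
- by split => // t t_gt0 _; exact: s_ge0.
- rewrite (RfunE p m (ltW g0) (ltW a0) (s_ge0 a a0)).
  by apply: ltW; near: a; exact: H.
Unshelve. all: by end_near. Qed.

Theorem proposition4p5 (R : realType) (d : nat) (hd : (1 <= d)%N)
  (F : R -> \bar R)
  (hF_proper : forall x : R, F x != -oo%E)
  (hF_lsc : lower_semicontinuous F)
  (hF_convex : econvex F)
  (hF_dom : (edom F)^° = [set x : R | 0 < x])
  (hF_diff : forall x : R, 0 < x -> derivable (fine \o F) x 1)
  (L0 : \bar R)
  (hL0 : (ederiv F xi)%:E @[xi --> 0^'+] --> L0)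
  (hL0_fin : L0 != +oo%E)
  (p : R) (hp : 1 < p)
  (gamma : R) (hgamma : 0 < gamma)
  (rho : R) (m : 'rV[R]_d) :
  let prox_is := is_prox (@enorm_pair R d)
    (fun x => (gamma%:E * (Phi p x + Psi F x))%E) (rho, m) in
  let lhs := rho + enorm m `^ p / (p * gamma `^ (p - 1)) in
  ((lhs%:E <= gamma%:E * L0)%E -> prox_is (0, 0)) /\
  ((gamma%:E * L0 < lhs%:E)%E ->
     exists r theta : R,
       [/\ is_prox (fun x : R => `|x|) (fun x => (gamma%:E * F x)%E) rho r,
           0 <= r,
           [set t : R | [/\ 0 < t, r <= t & Rfun F p gamma rho m t = 0]]
             = [set theta]
         & prox_is (theta, vsol F p gamma rho m theta)]).
Proof.
move=> prox_is lhs; have HF : convex_on_pos F by [].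
split=> [|gLl].
  case: L0 hL0 hL0_fin => [l| |] // gL _.
    by rewrite -EFinM lee_fin => hl; exact: prox_origin gL hp hgamma hl.
  by rewrite gt0_muleNy ?lte_fin.
have [r [a [rP [r0 s_ge0] a0 ra Ra]]] :=
  prox_F_and_Rfun_le0 HF hF_lsc hL0 hL0_fin hp hgamma gLl.
have [theta at_ Rt] := Rfun_root HF hp hgamma a0 (s_ge0 _ a0 ra) Ra.
have t0 : 0 < theta by exact: lt_le_trans at_.
have rt : r <= theta by exact: le_trans at_.
exists r, theta; split => //; last by apply: prox_root => //; exact: s_ge0.
apply/seteqP; split => [t [t_gt0 rt' Rt0] /=|t -> //].
case: (ltgtP t theta) => // tt.
  have := Rfun_lt m HF hp hgamma t_gt0 tt (s_ge0 _ t_gt0 rt').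
  by rewrite Rt Rt0 ltxx.
by have := Rfun_lt m HF hp hgamma t0 tt (s_ge0 _ t0 rt); rewrite Rt Rt0 ltxx.
Qed.
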